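(* Let $n\ge1$, $T\in\mathbb{R}$, let $\varphi:\mathbb{R}^n\to\mathbb{R}$ be an admissible payoff function, and let $\tilde\varphi=\varphi*\eta$ be its mollification. For every $\varepsilon>0$ a solution $w_\varepsilon(t,x)$, $t\in\{T,T-\varepsilon^2,T-2\varepsilon^2,\dots\}$, $x\in\mathbb{R}^n$, of the time-dependent dynamic programming principle $$w_\varepsilon(t,x)=\min_{player}\max_{market}\mathbf{E}[w_\varepsilon(t+\varepsilon^2,x+\varepsilon\Delta x)]\ \ (t<T),\qquad w_\varepsilon(T,x)=\varphi(x)$$ exists and is unique. In addition, there is a constant $C$ independent of $\varepsilon$ such that $$\|w_\varepsilon(t,\cdot)-\tilde\varphi\|_\infty<C(T-t+1)$$ for all such $t$. Moreover: 1. $w_\varepsilon(t,x)$ grows at most linearly as $|x|\to\infty$, with a bound that is uniform as $\varepsilon\to0$. 2. $w_\varepsilon$ is monotone nondecreasing in each variable $x_j$. 3. $w_\varepsilon(t,x_1+c,\dots,x_n+c)=w_\varepsilon(t,x_1,\dots,x_n)+c$ for all $c\in\mathbb{R}$.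
   Context: Admissible payoff: $\varphi:\mathbb{R}^n\to\mathbb{R}$ is globally Lipschitz continuous, non-decreasing in each variable, symmetric in $x_1,\dots,x_n$, satisfies $|\varphi(x)|\le C_1|x|+C_2$ for some constants, and satisfies $\varphi(x_1+c,\dots,x_n+c)=\varphi(x_1,\dots,x_n)+c$ for all $c\in\mathbb{R}$. Mollification: $\tilde\varphi=\varphi*\eta$ with $\eta(x)=c_\eta e^{-1/(1-|x|^2)}$ for $|x|<1$ and $\eta(x)=0$ for $|x|\ge1$, where $c_\eta$ is chosen so that $\int\eta=1$. Game operators: $\min_{player}$ is the minimum over probability vectors $\alpha=(\alpha_1,\dots,\alpha_n)$ ($\alpha_k\ge0$, $\sum_k\alpha_k=1$); $\max_{market}$ is the maximum over probability distributions $p$ on $\{0,1\}^n$. For given $\alpha,p$, $$\mathbf{E}[w(t+\varepsilon^2,x+\varepsilon\Delta x)]=\sum_{k=1}^n\alpha_k\sum_{v\in\{0,1\}^n}p(v)\,w\big(t+\varepsilon^2,x+\varepsilon(v-v_k\vec 1)\big),\qquad \vec 1=(1,\dots,1).$$ In item 1, ''at most linear growth with uniform bound'' means: for every $t_0\le T$ there are constants $A,B$ independent of $\varepsilon$ with $|w_\varepsilon(t,x)|\le A|x|+B$ for all $x$ and all times $t\in[t_0,T]$ at which $w_\varepsilon$ is defined. *)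

(* Defs.v *)
From HB Require Import structures.
From mathcomp Require Import all_boot all_order all_algebra perm.
From mathcomp Require Import all_classical all_reals all_analysis.

Set Implicit Arguments.
Unset Strict Implicit.
Unset Printing Implicit Defensive.

Import Order.TTheory GRing.Theory Num.Theory.
Import numFieldNormedType.Exports.

Local Open Scope classical_set_scope.
Local Open Scope ring_scope.

Section product_cons.
Local Open Scope ereal_scope.
Context d (T : measurableType d) (R : realType) (n : nat).
Variables (m : {sigma_finite_measure set T -> \bar R})
  (mn : {sigma_finite_measure set (n.-tuple T) -> \bar R}).

Definition tuple_cons (p : T * n.-tuple T) : n.+1.-tuple T :=
  [the n.+1.-tuple T of p.1 :: p.2].

Let measurable_tuple_cons : measurable_fun [set: T * n.-tuple T] tuple_cons.
Proof. by apply: measurable_cons. Qed.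

Definition product_cons : set (n.+1.-tuple T) -> \bar R :=
  pushforward (m \x mn) tuple_cons.

Let mpreimage A : measurable A -> measurable (tuple_cons @^-1` A).
Proof.
by move=> mA; rewrite -[X in measurable X]setTI; exact: measurable_tuple_cons.
Qed.

Let product_cons0 : product_cons set0 = 0.
Proof. by rewrite /product_cons /pushforward preimage_set0 measure0. Qed.

Let product_cons_ge0 A : 0 <= product_cons A.
Proof. exact: measure_ge0. Qed.

Let product_cons_sigma_additive : semi_sigma_additive product_cons.
Proof.
move=> F mF tF mUF; rewrite /product_cons /pushforward preimage_bigcup.
apply: measure_semi_sigma_additive => [i||].
- exact: mpreimage.
- apply/trivIsetP => i j _ _ ij; rewrite -preimage_setI.
  by move/trivIsetP : tF => /(_ _ _ _ _ ij) ->//; rewrite preimage_set0.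
- by rewrite -preimage_bigcup; exact: mpreimage.
Qed.

HB.instance Definition _ := isMeasure.Build _ _ _ product_cons
  product_cons0 product_cons_ge0 product_cons_sigma_additive.

Let product_cons_sigma_finite : sigma_finite setT product_cons.
Proof.
have /sigma_finiteP[F [FT ndF mF]] := sigma_finiteT m.
have /sigma_finiteP[G [GT ndG mG]] := sigma_finiteT mn.
pose uncons (t : n.+1.-tuple T) := (thead t, [tuple of behead t]).
have muncons : measurable_fun setT uncons.
  apply: (@measurable_fun_pair _ _ _ _ _ _
    (@thead n T) (fun t : n.+1.-tuple T => [tuple of behead t])).
    exact: measurable_tnth.
  exact: measurable_behead.
exists (fun i => uncons @^-1` (F i `*` G i)).
  apply/esym; rewrite -subTset => t _.
  have [i _ Fi] : (\bigcup_i F i) (thead t) by rewrite -FT.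
  have [j _ Gj] : (\bigcup_i G i) [tuple of behead t] by rewrite -GT.
  exists (maxn i j) => //; split => /=.
    by move: Fi; exact/subsetPset/ndF/leq_maxl.
  by move: Gj; exact/subsetPset/ndG/leq_maxr.
move=> i; have [mFi Fioo] := mF i; have [mGi Gioo] := mG i; split.
  rewrite -[X in measurable X]setTI; apply: muncons => //.
  exact: measurableX.
rewrite /product_cons /pushforward -comp_preimage (_ : _ \o _ = id).
  by rewrite preimage_id product_measure1E// lte_mul_pinfty// ge0_fin_numE.
by apply/funext => -[x t] /=; congr pair; exact: val_inj.
Qed.

HB.instance Definition _ := Measure_isSigmaFinite.Build _ _ _ product_cons
  product_cons_sigma_finite.

End product_cons.

(* The n-fold product of m with itself, characterized by tuple_measure_box. *)
Fixpoint tuple_measure d (T : measurableType d) (R : realType)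
    (m : {sigma_finite_measure set T -> \bar R}) (n : nat) :
    {sigma_finite_measure set (n.-tuple T) -> \bar R} :=
  match n with
  | 0%N => \d_ [tuple]
  | n'.+1 => product_cons m (tuple_measure m n')
  end.

Lemma tuple_measure_box d (T : measurableType d) (R : realType)
    (m : {sigma_finite_measure set T -> \bar R}) n (A : 'I_n -> set T) :
  (forall i, measurable (A i)) ->
  tuple_measure m n [set t | forall i, A i (tnth t i)] =
  (\prod_(i < n) m (A i))%E.
Proof.
elim: n A => [|n IH] A mA /=.
  rewrite big_ord0 diracE mem_set//.
  by move=> [].
rewrite big_ord_recl -IH; last by move=> i.
rewrite /product_cons /pushforward (_ : _ @^-1` _ =
  A ord0 `*` [set t | forall i, A (lift ord0 i) (tnth t i)]).
  rewrite product_measure1E//.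
  rewrite (_ : mkset _ = \bigcap_(i in [set: 'I_n])
     ((fun t => tnth t i) @^-1` A (lift ord0 i))); last first.
    by apply/seteqP; split=> t /= h; [move=> i _; exact: h|move=> i; exact: h].
  apply: fin_bigcap_measurable => // i _.
  rewrite -[X in measurable X]setTI; exact: measurable_tnth.
apply/seteqP; split=> -[x t] /=.
  move=> h; split; first exact: (h ord0).
  by move=> i; have := h (lift ord0 i); rewrite tnthS.
move=> [h0 h] i; case: (unliftP ord0 i) => [j ->|->]; last exact: h0.
by rewrite tnthS; exact: h.
Qed.

Definition lebesgue_tuple (R : realType) (n : nat) :
    {sigma_finite_measure set (n.-tuple (measurableTypeR R)) -> \bar R} :=
  tuple_measure (@lebesgue_measure R) n.

Section game.
Context (R : realType) (n : nat).
Implicit Types (x : 'rV[R]_n) (f : 'rV[R]_n -> R) (t eps : R).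

(* The library norm `|x| on 'rV[R]_n is the max norm. *)
Definition enorm x : R := Num.sqrt (\sum_(i < n) x 0 i ^+ 2).

Definition coord_nondecreasing f : Prop :=
  forall x (j : 'I_n) (h : R), 0 <= h -> f x <= f (x + h *: delta_mx 0 j).

Definition shift_equivariant f : Prop :=
  forall x (c : R), f (x + const_mx c) = f x + c.

Definition symmetric_fun f : Prop :=
  forall (s : 'S_n) x, f (\row_j x 0 (s j)) = f x.

Record admissible_payoff f : Prop := AdmissiblePayoff {
  admissible_lipschitz :
    exists L : R, forall x y, `|f x - f y| <= L * enorm (x - y) ;
  admissible_nondecreasing : coord_nondecreasing f ;
  admissible_symmetric : symmetric_fun f ;
  admissible_growth :
    exists C1 C2 : R, forall x, `|f x| <= C1 * enorm x + C2 ;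
  admissible_shift : shift_equivariant f }.

Definition integral_Rn f : R :=
  \int[lebesgue_tuple R n]_y f (\row_i tnth y i).

Definition bump_fun x : R :=
  if enorm x < 1 then expR (- 1 / (1 - enorm x ^+ 2)) else 0.

Definition eta x : R := (integral_Rn bump_fun)^-1 * bump_fun x.

Definition mollify f x : R := integral_Rn (fun y => f (x - y) * eta y).

Definition probability_vector (I : finType) (p : I -> R) : Prop :=
  (forall i, 0 <= p i) /\ \sum_i p i = 1.

Definition is_minimum (A : set R) (m : R) : Prop := A m /\ lbound A m.

Definition is_maximum (A : set R) (m : R) : Prop := A m /\ ubound A m.

(* v = minimum over alpha of (maximum over p of E alpha p), where both the
   player's and the market's extrema are required to be attained. *)
Definition is_minmax (I J : finType) (E : (I -> R) -> (J -> R) -> R) (v : R) :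
    Prop :=
  exists M : (I -> R) -> R,
    (forall alpha, probability_vector alpha ->
       is_maximum [set E alpha p | p in @probability_vector J] (M alpha)) /\
    is_minimum [set M alpha | alpha in @probability_vector I] v.

Definition outcome (v : {ffun 'I_n -> bool}) : 'rV[R]_n := \row_j (v j)%:R.

Definition expected_value (W : R -> 'rV[R]_n -> R) eps t x
    (alpha : 'I_n -> R) (p : {ffun 'I_n -> bool} -> R) : R :=
  \sum_k alpha k * \sum_v p v *
    W (t + eps ^+ 2) (x + eps *: (outcome v - const_mx (v k)%:R)).

Definition time_grid (T : R) eps : set R :=
  [set T - k%:R * eps ^+ 2 | k in [set: nat]].

(* Only the values of W at times in the grid are constrained. *)
Definition dpp_solution (T : R) f eps (W : R -> 'rV[R]_n -> R) : Prop :=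
  (forall t, time_grid T eps t -> t < T ->
     forall x, is_minmax (expected_value W eps t x) (W t x)) /\
  (forall x, W T x = f x).

Definition sup_norm f : \bar R :=
  ereal_sup [set `|f x|%:E | x in [set: 'rV[R]_n]].

End game.

(* Main.v *)
(* The value of each step is monotone in the terminal function and commutes with
   adding constants, which gives uniqueness, monotonicity and translation
   equivariance by induction on the number of steps; the player's minimum is
   attained because the market's best response is Lipschitz in alpha.

   The two-sided bound compares w with phi itself, as phi and its mollification
   differ by at most the Lipschitz constant L of phi. From below, the market may
   choose v = 0, so w >= phi. From above, the smooth supersolution is the Moreau
   envelope psi(x) = min_y phi(y) + |x - y|^2 / 2 >= phi(x) - L^2 / 2. If y is
   optimal for x, then x - y is a probability vector, since phi is nondecreasing
   and translation equivariant, and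
     psi(x + h) <= psi(x) + (x - y) . h + |h|^2 / 2.
   Playing alpha = x - y cancels the first-order term for every v, because
   sum_k alpha_k (alpha . v - v_k) = 0, so one step raises psi by at most
   n eps^2 / 2. *)

Require Import Defs.
From mathcomp Require Import all_boot all_order all_algebra.
From mathcomp Require Import all_classical all_reals all_analysis.
From mathcomp Require Import measurable_realfun ring lra.

Import Order.TTheory GRing.Theory Num.Theory.
Import numFieldNormedType.Exports.
Local Open Scope classical_set_scope.
Local Open Scope ring_scope.

(** * Finite min-max games: comparison and existence of values *)

Section matrix_games.
Context {R : realType}.

(** Take [al] optimal in the second game and [p] a best response to it in the first: [v <= M al = E
    al p <= E' al p + c <= M' al + c = v' + c]. *)
Lemma le_is_minmax {I J : finType} {E E' : (I -> R) -> (J -> R) -> R}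
    {c v v' : R} :
  (forall al p, probability_vector al -> probability_vector p ->
     E al p <= E' al p + c) ->
  is_minmax E v -> is_minmax E' v' -> v <= v' + c.
Proof.
move=> EE' [M [hM [_ lbM]]] [M' [hM' [[al pal <-] _]]].
apply: (@le_trans _ _ (M al)); first by apply: lbM; exists al.
have [[p pp <-] _] := hM al pal.
apply: (le_trans (EE' _ _ pal pp)); rewrite lerD2r.
by apply: (hM' al pal).2; exists p.
Qed.

Lemma is_minmax_le {I J : finType} {E : (I -> R) -> (J -> R) -> R}
    (al : I -> R) {v b : R} :
  probability_vector al -> (forall p, probability_vector p -> E al p <= b) ->
  is_minmax E v -> v <= b.
Proof.
move=> pal Eb [M [hM [_ lbM]]].
apply: (@le_trans _ _ (M al)); first by apply: lbM; exists al.
by have [[p pp <-] _] := hM al pal; exact: Eb.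
Qed.

Lemma is_minmax_ge {I J : finType} {E : (I -> R) -> (J -> R) -> R}
    (p : J -> R) {v b : R} :
  probability_vector p -> (forall al, probability_vector al -> b <= E al p) ->
  is_minmax E v -> b <= v.
Proof.
move=> pp bE [M [hM [[al pal <-] _]]].
apply: (le_trans (bE _ pal)).
by apply: (hM al pal).2; exists p.
Qed.

Lemma is_minmax_unique {I J : finType} {E : (I -> R) -> (J -> R) -> R}
    {v v' : R} :
  is_minmax E v -> is_minmax E v' -> v = v'.
Proof.
move=> Ev Ev'; apply/le_anti/andP; split; rewrite -[leRHS]addr0.
  by apply: le_is_minmax Ev Ev' => al p _ _; rewrite addr0.
by apply: le_is_minmax Ev' Ev => al p _ _; rewrite addr0.
Qed.

Lemma probability_vector_dirac {J : finType} (j0 : J) :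
  probability_vector (fun j => (j == j0)%:R : R).
Proof.
split=> [j|]; first by rewrite ler0n.
by rewrite (bigD1 j0)//= eqxx big1 ?addr0// => j /negPf ->.
Qed.

Lemma sum_dirac {J : finType} (j0 : J) (F : J -> R) :
  \sum_j (j == j0)%:R * F j = F j0.
Proof.
rewrite (bigD1 j0)//= eqxx mul1r big1 ?addr0// => j /negPf ->.
by rewrite mul0r.
Qed.

Lemma ler_expectation {J : finType} {p F : J -> R} {b : R} :
  probability_vector p -> (forall j, F j <= b) -> \sum_j p j * F j <= b.
Proof.
move=> [p0 p1] Fb; rewrite -[leRHS]mul1r -p1 mulr_suml.
by apply: ler_sum => j _; exact: ler_wpM2l.
Qed.

Definition expected_payoff {n} {J : finType} (A : 'I_n -> J -> R)
  (al : 'I_n -> R) (p : J -> R) : R := \sum_k al k * \sum_j p j * A k j.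

(** For fixed [al] the payoff is an average over [p] of the payoffs of pure outcomes, so some pure
    outcome is a best response. *)
Lemma expected_payoffE {n} {J : finType} (A : 'I_n -> J -> R) al p :
  expected_payoff A al p = \sum_j p j * \sum_k al k * A k j.
Proof.
rewrite /expected_payoff; under eq_bigr do rewrite mulr_sumr.
rewrite exchange_big; apply: eq_bigr => j _; rewrite mulr_sumr.
by apply: eq_bigr => k _; rewrite mulrCA.
Qed.

Lemma le_expected_payoff {n} {J : finType} {A A' : 'I_n -> J -> R} {c al p} :
  (forall k j, A k j <= A' k j + c) ->
  probability_vector al -> probability_vector p ->
  expected_payoff A al p <= expected_payoff A' al p + c.
Proof.
move=> AA' [al0 al1] [p0 p1].
rewrite -[X in _ + X]mul1r -al1 mulr_suml -big_split/=.
apply: ler_sum => k _; rewrite -mulrDr ler_wpM2l//.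
rewrite -[X in _ + X]mul1r -p1 mulr_suml -big_split/=.
by apply: ler_sum => j _; rewrite -mulrDr ler_wpM2l.
Qed.

Lemma le_minmax_payoff {n} {J : finType} {A A' : 'I_n -> J -> R} {c v v'} :
  (forall k j, A k j <= A' k j + c) ->
  is_minmax (expected_payoff A) v -> is_minmax (expected_payoff A') v' ->
  v <= v' + c.
Proof.
by move=> AA'; apply: le_is_minmax => al p; exact: le_expected_payoff.
Qed.

Lemma lipschitz_rV_continuous {n} (f : 'rV[R]_n -> R) (L : R) :
  (forall x y, `|f x - f y| <= L * `|x - y|) -> continuous f.
Proof.
move=> fL x; apply/(@cvgrPdist_lt _ _ _ (nbhs x) (nbhs_filter x)) => e e0.
near=> y; apply: (le_lt_trans (fL _ _)).
apply: (@le_lt_trans _ _ ((`|L| + 1) * `|x - y|)).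
  by rewrite ler_wpM2r// (le_trans (ler_norm L))// lerDl.
rewrite mulrC -ltr_pdivlMr ?ltr_wpDl//.
near: y; apply: (@nbhs_normP R _ x (fun y => `|x - y| < e / (`|L| + 1))).2.
by exists (e / (`|L| + 1)) => //=; rewrite divr_gt0// ltr_wpDl.
Unshelve. all: by end_near. Qed.

Lemma le_coord_norm {n} (x : 'rV[R]_n) i : `|x 0 i| <= `|x|.
Proof.
rewrite [leRHS]/Num.norm/= mx_normrE.
by rewrite (le_trans _ (le_bigmax _ _ (ord0, i))).
Qed.

(** The simplex is the closed set where the coordinates sum to 1, cut out of the compact cube with
    sides [0, 1]. *)
Lemma compact_simplex n :
  compact [set x : 'rV[R]_n | probability_vector (x ord0)].
Proof.
rewrite (_ : mkset _ = [set x : 'rV[R]_n | forall i, `[0, 1]%classic (x ord0 i)]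
   `&` (fun x => \sum_i x ord0 i) @^-1` [set 1]); last first.
  apply/seteqP; split => x /=.
    move=> [x0 x1]; split=> // i; rewrite in_itv/= x0/= -x1.
    by rewrite (bigD1 i)//= lerDl sumr_ge0.
  by move=> [x0 x1]; split=> // i; have := x0 i; rewrite in_itv/= => /andP[].
apply: compact_closedI.
  exact: (@rV_compact R n (fun=> `[0, 1]%classic)
    (fun=> @segment_compact R 0 1)).
apply: preimage_closed; last exact: closed_eq.
move=> x _; apply: continuous_big => [|i _]; last exact: coord_continuous.
exact: add_continuous.
Qed.

Lemma minmax_exists {n} {J : finType} (j0 : J) (A : 'I_n -> J -> R) :
  (0 < n)%N -> exists v, is_minmax (expected_payoff A) v.
Proof.
move=> n0.
pose b (al : 'I_n -> R) j := \sum_k al k * A k j.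
(* Maximum over the finitely many pure outcomes; [j0] witnesses that there is one. *)
pose M al := b al [arg max_(j > j0) b al j]%O.
have bM al j : b al j <= M al by rewrite /M; case: arg_maxP => // i _; exact.
have hM al : is_maximum
    [set expected_payoff A al p | p in @probability_vector _ J] (M al).
  split.
    exists (fun j => (j == [arg max_(j > j0) b al j]%O)%:R).
      exact: probability_vector_dirac.
    by rewrite expected_payoffE sum_dirac.
  move=> _ [p pp <-]; rewrite expected_payoffE.
  exact: ler_expectation pp (bM al).
(* Each [b al j] is Lipschitz in [al] with a constant uniform in [j], and the maximum inherits
   it. *)
have cM : continuous (fun x : 'rV[R]_n => M (x ord0)).
  apply: (@lipschitz_rV_continuous n _ (\sum_k \sum_j `|A k j|)).
  have half (x y : 'rV[R]_n) :
      M (x ord0) - M (y ord0) <= (\sum_k \sum_j `|A k j|) * `|x - y|.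
    rewrite lerBlDl {1}/M; set j := [arg max_(_ > _) _]%O.
    apply: (@le_trans _ _ (b (y ord0) j + (\sum_k \sum_j `|A k j|) * `|x - y|)).
      rewrite -lerBlDl /b -sumrB mulr_suml; apply: ler_sum => k _.
      rewrite -mulrBl (le_trans (ler_norm _))// normrM mulrC.
      apply: ler_pM => //.
        by rewrite (bigD1 j)//= lerDl sumr_ge0.
      by have := le_coord_norm (x - y) k; rewrite !mxE.
    by rewrite lerD2r.
  move=> x y; rewrite ler_norml half andbT lerNl opprB.
  by rewrite distrC half.
have [|x] := compact_EVT_min
  (A := [set x : 'rV[R]_n | probability_vector (x ord0)]) _
  (@compact_simplex n) (continuous_subspaceT cM).
  (* A vertex shows that the simplex is nonempty; this is where [0 < n] enters. *)
  exists (\row_j (j == Ordinal n0)%:R) => /=.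
  have [h1 h2] := probability_vector_dirac (Ordinal n0).
  split => [i|]; first by rewrite mxE.
  by rewrite -[RHS]h2; apply: eq_bigr => i _; rewrite mxE.
rewrite inE => px xmin.
exists (M (x ord0)), M; split => [al _|]; first exact: hM.
split; first by exists (x ord0).
move=> _ [al pal <-].
have -> : al = (\row_j al j) ord0 by apply/funext => j; rewrite mxE.
apply: xmin; rewrite inE /=.
by rewrite (_ : _ ord0 = al)//; apply/funext => j; rewrite mxE.
Qed.

End matrix_games.

(** * The Euclidean norm and its comparison with the max norm *)

Section euclidean_norm.
Context {R : realType} {n : nat}.
Implicit Types x y : 'rV[R]_n.

Lemma enorm_ge0 x : 0 <= enorm x.
Proof. exact: sqrtr_ge0. Qed.

Lemma sqr_enorm x : enorm x ^+ 2 = \sum_i x 0 i ^+ 2.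
Proof. by rewrite sqr_sqrtr// sumr_ge0// => i _; exact: sqr_ge0. Qed.

Lemma sqr_enormD x y :
  enorm (x + y) ^+ 2 = enorm x ^+ 2 + 2 * (\sum_i x 0 i * y 0 i) + enorm y ^+ 2.
Proof.
rewrite !sqr_enorm mulr_sumr -!big_split/=; apply: eq_bigr => i _.
by rewrite mxE; ring.
Qed.

Lemma le_coord_enorm x i : `|x 0 i| <= enorm x.
Proof.
rewrite -sqrtr_sqr ler_wsqrtr// (bigD1 i)//= lerDl.
by rewrite sumr_ge0// => j _; exact: sqr_ge0.
Qed.

Lemma enorm_le_norm x : enorm x <= Num.sqrt n%:R * `|x|.
Proof.
rewrite -[X in _ * X]normr_id -sqrtr_sqr -sqrtrM// ler_wsqrtr//.
have -> : n%:R = \sum_(i < n) 1 :> R by rewrite sumr_const card_ord.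
rewrite mulr_suml; apply: ler_sum => i _.
by rewrite mul1r -[leLHS]real_normK ?num_real// lerXn2r ?nnegrE// le_coord_norm.
Qed.

End euclidean_norm.

(** * The Moreau envelope and its proximal points *)

Section moreau_envelope.
Context {R : realType} {n : nat}.
Variables (phi : 'rV[R]_n -> R) (L : R).
Hypotheses (L_ge0 : 0 <= L)
  (phiL : forall x y, `|phi x - phi y| <= L * enorm (x - y)).

(** The Moreau envelope at [x] is the minimum of this over [y]. Keeping [y] free lets a bound by the
    envelope be stated as a bound for every [y]. *)
Definition proximal_cost x y := phi y + enorm (x - y) ^+ 2 / 2.

Lemma le_proximal_cost x y : phi x <= proximal_cost x y + L ^+ 2 / 2.
Proof.
have := phiL x y; rewrite ler_norml => /andP[_ h].
have := sqr_ge0 (enorm (x - y) - L); rewrite /proximal_cost; nra.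
Qed.

Lemma proximal_cost_continuous x : continuous (proximal_cost x).
Proof.
have cphi : continuous phi.
  apply: (@lipschitz_rV_continuous _ _ _ (L * Num.sqrt n%:R)) => y z.
  by rewrite (le_trans (phiL _ _))// -mulrA ler_wpM2l// enorm_le_norm.
move=> y; rewrite /continuous_at /proximal_cost.
apply: (@cvgD _ _ _ (nbhs y)); first exact: cphi.
apply: cvgM; last exact: cvg_cst.
have enormE z : enorm (x - z) ^+ 2 = \sum_i (x 0 i - z 0 i) * (x 0 i - z 0 i).
  by rewrite sqr_enorm; apply: eq_bigr => i _; rewrite !mxE expr2.
rewrite enormE; under eq_fun do rewrite enormE.
apply: cvg_big => [|i _]; first exact: add_continuous.
by apply: cvgM; apply: cvgB; by [exact: cvg_cst|exact: coord_continuous].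
Qed.

(** A minimizer over the box of half-width [2 * L] around [x] is global: outside it s = |x - z|
    exceeds 2L, so s^2/2 outweighs the possible gain L s and [z] costs at least as much as [x]
    itself. *)
Lemma proximal_point x :
  exists y, forall z, proximal_cost x y <= proximal_cost x z.
Proof.
pose A i := `[x ord0 i - 2 * L, x ord0 i + 2 * L]%classic.
have cA : compact [set z : 'rV[R]_n | forall i, A i (z ord0 i)].
  exact: (@rV_compact R n A (fun=> @segment_compact R _ _)).
have xA : [set z : 'rV[R]_n | forall i, A i (z ord0 i)] x.
  by move=> i; rewrite /A/= in_itv/= -ler_distl subrr normr0 mulr_ge0.
have cf := continuous_subspaceT (@proximal_cost_continuous x).
have [y _ ymin] := compact_EVT_min (ex_intro _ x xA) cA (cf _).
exists y => z; have [zA|] := pselect (forall i, A i (z ord0 i)).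
  by apply: ymin; rewrite inE.
move=> /existsNP[i]; rewrite /A/= in_itv/= -ler_distl => /negP.
rewrite -ltNge => Lz; apply: (@le_trans _ _ (proximal_cost x x)).
  by apply: ymin; rewrite inE.
have := le_coord_enorm (x - z) i; rewrite !mxE distrC => /(lt_le_trans Lz) {}Lz.
have := phiL x z; rewrite ler_norml => /andP[_ h].
rewrite /proximal_cost subrr; have -> : enorm (0 : 'rV[R]_n) ^+ 2 = 0.
  by rewrite sqr_enorm big1// => j _; rewrite mxE expr0n.
move: (enorm (x - z)) Lz h => s Lz h.
have : 0 <= (s - 2 * L) * (s - 2 * L) by rewrite -expr2 sqr_ge0.
have : 0 <= L * (s - 2 * L) by rewrite mulr_ge0// subr_ge0 ltW.
by rewrite expr2; lra.
Qed.

Lemma proximal_gradient_probability x y :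
  (0 < n)%N -> coord_nondecreasing phi -> shift_equivariant phi ->
  (forall z, proximal_cost x y <= proximal_cost x z) ->
  probability_vector ((x - y) ord0).
Proof.
move=> n0 phi_nd phi_shift ymin.
(* Optimality of [y] against the competitor [y - h], with the square expanded. *)
have key h :
    0 <= phi (y - h) - phi y + \sum_i (x - y) 0 i * h 0 i + enorm h ^+ 2 / 2.
  have := ymin (y - h); rewrite /proximal_cost.
  have -> : x - (y - h) = (x - y) + h by rewrite opprB addrA addrAC.
  rewrite (sqr_enormD (x - y) h); set s := \sum_i _; lra.
split.
  (* If the coordinate [a] were negative, h = -a e_j would not increase [phi], while the other terms
     give -a^2 + a^2/2 < 0, against [key]. *)
  move=> j; rewrite leNgt; apply/negP => a_lt0; set a := (x - y) 0 j in a_lt0 *.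
  have := key (- a *: delta_mx 0 j).
  have := phi_nd (y - - a *: delta_mx 0 j) j (- a).
  rewrite oppr_ge0 (ltW a_lt0) subrK => /(_ isT).
  rewrite (bigD1 j)//= big1 ?addr0; last first.
    move=> i /negPf ij.
    by rewrite [X in _ * X]mxE [X in _ * (_ * X)]mxE ij andbF !mulr0.
  rewrite sqr_enorm (bigD1 j)//= big1 ?addr0; last first.
    by move=> i /negPf ij; rewrite mxE [X in _ * X]mxE ij andbF mulr0 expr0n.
  rewrite [X in _ * X]mxE [X in _ * (_ * X)]mxE -/a.
  rewrite [X in X ^+ 2]mxE [X in (_ * X) ^+ 2]mxE !eqxx !mulr1.
  by nra.
set S := \sum_i _.
have nR0 : (0 < n%:R :> R) by rewrite ltr0n.
(* For a constant shift by c = (1 - S)/n, translation equivariance turns [key] into -c(1 - S)/2 >=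
   0, that is (1 - S)^2 <= 0. *)
have := key (const_mx (n%:R^-1 * (1 - S))); set c := _ * _.
have -> : \sum_i (x - y) 0 i * (const_mx c : 'rV[R]_n) 0 i = S * c.
  by rewrite mulr_suml; apply: eq_bigr => i _; rewrite [X in _ * X]mxE.
rewrite sqr_enorm; under [X in _ + X / 2]eq_bigr do rewrite mxE.
rewrite sumr_const card_ord.
have -> : y - const_mx c = y + const_mx (- c).
  by congr (_ + _); apply/rowP => i; rewrite !mxE.
rewrite phi_shift.
have cn : c * n%:R = 1 - S by rewrite /c mulrC mulrA mulfV ?mul1r// gt_eqF.
have -> : c ^+ 2 *+ n = c * (1 - S) by rewrite -mulr_natr -cn expr2 mulrA.
move=> h.
have {h} : c * (1 - S) <= 0 by lra.
have -> : c * (1 - S) = n%:R^-1 * (1 - S) ^+ 2 by rewrite /c expr2 mulrA.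
rewrite pmulr_rle0 ?invr_gt0// => h.
have : (1 - S) ^+ 2 == 0 by rewrite eq_le h sqr_ge0.
by rewrite sqrf_eq0 subr_eq0 => /eqP.
Qed.

End moreau_envelope.

(** * Monotonicity of the integral *)

Section integral_monotone.
Local Open Scope ereal_scope.
Context {d} {T : measurableType d} {R : realType}.
Variable mu : {measure set T -> \bar R}.
Import HBNNSimple.

(** The integral of a nonnegative function is a supremum over its simple minorants, and every
    minorant of [f] is one of [g]. *)
Let ge0_integral_monotone (f g : T -> \bar R) :
  (forall x, 0 <= f x) -> (forall x, f x <= g x) ->
  \int[mu]_x f x <= \int[mu]_x g x.
Proof.
move=> f0 fg; have g0 x : 0 <= g x by exact: le_trans (fg x).
rewrite !ge0_integralTE//; apply: ge_ereal_sup => _ [h /= hf <-].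
apply: le_ereal_sup_tmp; exists (sintegral mu h) => //.
by exists h => // x; exact: le_trans (fg x).
Qed.

(* Unlike [le_integral], this needs no measurability of [f] and [g]. *)
Lemma integral_monotone (f g : T -> \bar R) :
  (forall x, f x <= g x) -> \int[mu]_x f x <= \int[mu]_x g x.
Proof.
move=> fg; rewrite integralE [leRHS]integralE.
apply: leeB; apply: ge0_integral_monotone => // x.
- by apply: (@funepos_le _ _ setT) => [y _|]; rewrite ?inE.
- by apply: (@funeneg_le _ _ setT) => [y _|]; rewrite ?inE.
Qed.

End integral_monotone.

(** * Normalization of the bump and distance from [phi] to its mollification *)

Section mollification.
Context {R : realType} {n : nat}.
Local Notation mu := (lebesgue_tuple R n).
Local Notation row y := (\row_i tnth y i).

Definition cube (a : R) : set (n.-tuple (measurableTypeR R)) :=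
  [set t | forall i, `[- a, a]%classic (tnth t i)].

Lemma measurable_cube (a : R) : measurable (cube a).
Proof.
rewrite (_ : cube a = \bigcap_(i in [set: 'I_n])
    ((fun t => tnth t i) @^-1` `[- a, a]%classic)); last first.
  by apply/seteqP; split=> t /= h; [move=> i _; exact: h|move=> i; exact: h].
apply: fin_bigcap_measurable => // i _.
by rewrite -[X in measurable X]setTI; exact: measurable_tnth.
Qed.

Lemma lebesgue_cube (a : R) : 0 < a -> mu (cube a) = ((2 * a) ^+ n)%:E.
Proof.
move=> a0.
transitivity (\prod_(i < n) @lebesgue_measure R `[(- a)%R, a]%classic)%E.
  exact: (@tuple_measure_box _ _ _ (@lebesgue_measure R) n
    (fun=> `[- a, a]%classic)).
under eq_bigr do rewrite lebesgue_measure_itv/= lte_fin gtrN//.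
rewrite -EFinB prodEFin prodr_const card_ord.
by congr (_ ^+ _)%:E; ring.
Qed.

Lemma bump_fun_ge0 (x : 'rV[R]_n) : 0 <= bump_fun x.
Proof. by rewrite /bump_fun; case: ifP => // _; exact: expR_ge0. Qed.

Lemma measurable_bump :
  measurable_fun [set: n.-tuple (measurableTypeR R)]
    (fun y => bump_fun (row y) : R).
Proof.
(* The bump is a function [g] of the squared norm. As [Num.sqrt] vanishes on negative reals, [g] is
   nonincreasing on the whole line, hence measurable. *)
pose g (u : R) : R :=
  if Num.sqrt u < 1 then expR (- 1 / (1 - Num.sqrt u ^+ 2)) else 0.
rewrite (_ : (fun _ => _) =
    g \o (fun y : n.-tuple (measurableTypeR R) => \sum_i tnth y i ^+ 2));
  last first.
  apply/funext => y; rewrite /bump_fun /g /enorm /=.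
  by under eq_bigr do rewrite mxE.
apply: measurableT_comp.
  apply: nonincreasing_measurable => // u v uv; rewrite /g.
  have uv' : Num.sqrt u <= Num.sqrt v by exact: ler_wsqrtr.
  case: ifPn => [v1|_]; last by case: ifP => // _; exact: expR_ge0.
  have u1 := le_lt_trans uv' v1; rewrite u1 ler_expR !mulN1r lerN2.
  have := sqrtr_ge0 u => u0.
  by rewrite lef_pV2 ?posrE; nra.
apply: measurable_sum => i; apply: measurable_funX; exact: measurable_tnth.
Qed.

(** The bump is at most 1 and supported in the cube of half-width 1, and at least exp(-2) on a
    smaller cube, so its integral is finite and positive. *)
Lemma bump_integral :
  exists2 Z : R, 0 < Z & (\int[mu]_y (bump_fun (row y))%:E = Z%:E)%E.
Proof.
pose I := (\int[mu]_y (bump_fun (row y))%:E)%E.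
have Ioo : (I <= ((2 * 1) ^+ n)%:E)%E.
  rewrite -lebesgue_cube// -[cube 1]setIT -integral_indic//;
    last exact: measurable_cube.
  apply: integral_monotone => y; rewrite lee_fin indicE /bump_fun.
  case: ifPn => // e1; rewrite mem_set.
    rewrite -[leRHS]expR0 ler_expR mulN1r oppr_le0 invr_ge0 subr_ge0.
    by rewrite expr_le1 ?enorm_ge0// ltW.
  move=> i; have := le_coord_enorm (row y) i; rewrite mxE.
  move=> /le_trans/(_ (ltW e1)).
  by rewrite /= in_itv/= ler_norml.
(* Small enough that |y|^2 <= n a^2 <= 1/2 on [cube a], where the exponent is then at least -2. *)
pose a : R := (2 * n.+1%:R)^-1.
have a0 : 0 < a by rewrite invr_gt0 mulr_gt0.
have Ige : ((expR (- 2) * (2 * a) ^+ n)%:E <= I)%E.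
  rewrite EFinM -lebesgue_cube// -[cube a]setIT -integral_indic//;
    last exact: measurable_cube.
  rewrite -ge0_integralZl_EFin ?expR_ge0//.
  - apply: integral_monotone => y; rewrite -EFinM lee_fin indicE.
    have [ya|_] := boolP (y \in cube a); last by rewrite mulr0 bump_fun_ge0.
    have e2 : enorm (row y) ^+ 2 <= 2^-1.
      rewrite sqr_enorm (@le_trans _ _ (\sum_(i < n) a ^+ 2))//.
        apply: ler_sum => i _; rewrite mxE.
        move: ya; rewrite inE => /(_ i); rewrite /= in_itv/= -ler_norml => ya.
        by rewrite -[leLHS]real_normK ?num_real// lerXn2r ?nnegrE// ltW.
      rewrite sumr_const card_ord -mulr_natr.
      have n0 : 0 <= n%:R :> R by [].
      have : a * (2 * (n%:R + 1)) = 1 by rewrite natr1 mulVf.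
      nra.
    have e1 : enorm (row y) < 1 by have := enorm_ge0 (row y); nra.
    rewrite mulr1 /bump_fun e1 ler_expR mulN1r lerN2 -[leRHS]invrK.
    rewrite lef_pV2 ?posrE; lra.
  - by apply/measurable_EFinP; exact: measurable_indic (measurable_cube a).
have c0 : 0 < expR (- 2) * (2 * a) ^+ n.
  by rewrite mulr_gt0 ?expR_gt0// exprn_gt0// mulr_gt0.
rewrite -/I; move: I Ioo Ige => [Z| |]//= _.
by rewrite lee_fin => /(lt_le_trans c0) Z0; exists Z.
Qed.

(** [eta] has mass 1 and lives in the unit ball, where [phi (x - y)] is within [L] of [phi x]; the
    integrand thus lies between [(phi x - L) * eta y] and [(phi x + L) * eta y]. *)
Lemma mollify_dist (phi : 'rV[R]_n -> R) (L : R) :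
  0 <= L -> (forall x y, `|phi x - phi y| <= L * enorm (x - y)) ->
  forall x, `|mollify phi x - phi x| <= L.
Proof.
move=> L0 phiL x; have [Z Z0 IZ] := bump_integral.
have etaE (y : 'rV[R]_n) : eta y = Z^-1 * bump_fun y :> R.
  by rewrite /eta /integral_Rn /Rintegral IZ.
have eta_cst c : (\int[mu]_y (c * eta (row y))%:E = c%:E)%E.
  under eq_integral do rewrite etaE mulrA EFinM.
  rewrite integralZl//.
    by rewrite IZ -EFinM divfK// gt_eqF.
  apply/integrableP; split.
    by apply/measurable_EFinP; exact: measurable_bump.
  under eq_integral do rewrite gee0_abs ?lee_fin ?bump_fun_ge0//.
  by rewrite IZ ltry.
have near_phi (y : 'rV[R]_n) :
    (phi x - L) * eta y <= phi (x - y) * eta y <= (phi x + L) * eta y.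
  have [y1|y1] := ltP (enorm y) 1; last first.
    by rewrite etaE /bump_fun ltNge y1/= !mulr0 lexx.
  have eta0 : 0 <= eta y by rewrite etaE mulr_ge0 ?bump_fun_ge0// invr_ge0 ltW.
  have := phiL (x - y) x; rewrite addrAC subrr add0r.
  have -> : enorm (- y) = enorm y.
    by rewrite /enorm; under eq_bigr do rewrite mxE sqrrN.
  move=> /le_trans/(_ (ler_piMr L0 (ltW y1))).
  rewrite ler_norml => /andP[h1 h2].
  by rewrite !ler_wpM2r//; lra.
have h1 : ((phi x - L)%:E <= \int[mu]_y (phi (x - row y) * eta (row y))%:E)%E.
  rewrite -eta_cst; apply: integral_monotone => y; rewrite lee_fin.
  by have /andP[] := near_phi (row y).
have h2 : (\int[mu]_y (phi (x - row y) * eta (row y))%:E <= (phi x + L)%:E)%E.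
  rewrite -[leRHS]eta_cst; apply: integral_monotone => y; rewrite lee_fin.
  by have /andP[] := near_phi (row y).
rewrite /mollify /integral_Rn /Rintegral.
(* The two bounds exclude infinite values, so the real-valued integral is the true one and not a
   default. *)
move: (integral _ _ _) h1 h2 => [r| |]//=; rewrite !lee_fin => h1 h2.
by rewrite ler_distl h1 h2.
Qed.

End mollification.

(** * The dynamic programming principle on the time grid *)

Section dynamic_programming.
Context {R : realType} {n : nat}.
Context {T : R} {phi : 'rV[R]_n -> R} {eps : R}.
Hypothesis eps_gt0 : 0 < eps.

Definition market_move (k : 'I_n) (v : {ffun 'I_n -> bool}) : 'rV[R]_n :=
  eps *: (outcome R v - const_mx (v k)%:R).

(** With this matrix [expected_payoff] unfolds to [expected_value], so each time step is a finite
    game. *)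
Definition shift_payoff (f : 'rV[R]_n -> R) x k v : R :=
  f (x + market_move k v).

Definition grid_time (k : nat) : R := T - k%:R * eps ^+ 2.

Lemma grid_time0 : grid_time 0 = T.
Proof. by rewrite /grid_time mul0r subr0. Qed.

Lemma grid_timeS k : grid_time k.+1 + eps ^+ 2 = grid_time k.
Proof. by rewrite /grid_time -natr1; ring. Qed.

Lemma time_grid_time k : time_grid T eps (grid_time k).
Proof. by exists k. Qed.

Lemma dpp_minmax {W} k x : dpp_solution T phi eps W ->
  is_minmax (expected_payoff (shift_payoff (W (grid_time k)) x))
    (W (grid_time k.+1) x).
Proof.
move=> [/(_ _ (time_grid_time k.+1)) step _].
rewrite -grid_timeS; apply: step.
by rewrite /grid_time gtrBl mulr_gt0 ?exprn_gt0.
Qed.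

(** Backward induction from [T]: a property of [phi] that survives one game step holds at all grid
    times. *)
Lemma dpp_grid_ind {W} {P : ('rV[R]_n -> R) -> Prop} :
  dpp_solution T phi eps W -> P phi ->
  (forall f g, P f ->
    (forall x, is_minmax (expected_payoff (shift_payoff f x)) (g x)) -> P g) ->
  forall t, time_grid T eps t -> P (W t).
Proof.
move=> solW P0 PS _ [k _ <-]; elim: k => [|k IH].
  rewrite -/(grid_time 0) grid_time0 (_ : W T = phi)//.
  by apply/funext; exact: solW.2.
by apply: PS IH _ => x; exact: dpp_minmax.
Qed.

Lemma dpp_exists : (0 < n)%N -> exists W, dpp_solution T phi eps W.
Proof.
move=> n0.
have [S SP] : exists S : ('rV[R]_n -> R) -> 'rV[R]_n -> R, forall f x,
    is_minmax (expected_payoff (shift_payoff f x)) (S f x).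
  have /choice[S SP] : forall fx : ('rV[R]_n -> R) * 'rV[R]_n, exists v,
      is_minmax (expected_payoff (shift_payoff fx.1 fx.2)) v.
    by move=> fx; exact: minmax_exists [ffun=> false] _ n0.
  by exists (fun f x => S (f, x)) => f x; exact: SP (f, x).
(* On the grid [(T - t) / eps ^+ 2] is exactly the number of steps; truncation only supplies values
   elsewhere. *)
pose W t := iter (Num.truncn ((T - t) / eps ^+ 2)) S phi.
have WE k : W (grid_time k) = iter k S phi.
  rewrite /W /grid_time opprB addrC subrK mulfK ?natrK//.
  by rewrite gt_eqF// exprn_gt0.
exists W; split => [_ [[|k] _ <-] + x|x].
- by rewrite mul0r subr0 ltxx.
- move=> _; rewrite -/(grid_time k.+1) WE/= /expected_value grid_timeS WE.
  exact: SP.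
- by rewrite -[in LHS]grid_time0 WE.
Qed.

Lemma dpp_unique {W W'} :
  dpp_solution T phi eps W -> dpp_solution T phi eps W' ->
  forall t, time_grid T eps t -> forall x, W' t x = W t x.
Proof.
move=> solW solW' _ [k _ <-]; elim: k => [|k IH] x.
  by rewrite mul0r subr0 solW.2 solW'.2.
have m := dpp_minmax k x solW; have m' := dpp_minmax k x solW'.
have WW' : W' (grid_time k) = W (grid_time k) by apply/funext.
rewrite WW' in m'.
exact: is_minmax_unique m' m.
Qed.

Lemma dpp_coord_nondecreasing {W} : dpp_solution T phi eps W ->
  coord_nondecreasing phi ->
  forall t, time_grid T eps t -> coord_nondecreasing (W t).
Proof.
move=> solW phi_nd; apply: dpp_grid_ind solW phi_nd _ => f g f_nd fg x j h h0.
rewrite -[leRHS]addr0; apply: le_minmax_payoff (fg _) (fg _) => k v.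
by rewrite addr0 /shift_payoff (addrAC x); exact: f_nd.
Qed.

(** Shifting [x] by [c] changes every matrix entry by exactly [c]; comparing the two games in both
    directions gives equality. *)
Lemma dpp_shift_equivariant {W} : dpp_solution T phi eps W ->
  shift_equivariant phi ->
  forall t, time_grid T eps t -> shift_equivariant (W t).
Proof.
move=> solW phi_sh; apply: dpp_grid_ind solW phi_sh _ => f g f_sh fg x c.
apply/le_anti/andP; split.
  apply: le_minmax_payoff (fg _) (fg _) => k v.
  by rewrite /shift_payoff (addrAC x) f_sh.
rewrite -lerBrDr; apply: le_minmax_payoff (fg _) (fg _) => k v.
by rewrite /shift_payoff (addrAC x) f_sh addrK.
Qed.

(* The outcome [v = 0] leaves [x] unchanged whatever the player does. *)
Lemma dpp_ge_payoff {W} : dpp_solution T phi eps W ->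
  forall t, time_grid T eps t -> forall x, phi x <= W t x.
Proof.
move=> solW.
apply: (dpp_grid_ind (P := fun f => forall x, phi x <= f x) solW) => //.
move=> f g phif fg x.
apply: is_minmax_ge (probability_vector_dirac [ffun=> false]) _ (fg x).
move=> al [_ al1]; rewrite /expected_payoff; under eq_bigr do rewrite sum_dirac.
rewrite (_ : \sum_k _ = \sum_k al k * f x).
  by rewrite -mulr_suml al1 mul1r.
apply: eq_bigr => k _; rewrite /shift_payoff /market_move; congr (_ * f _).
rewrite (_ : outcome R _ - _ = 0) ?scaler0 ?addr0//.
by apply/rowP => i; rewrite !mxE !ffunE subr0.
Qed.

Lemma market_moveE k v j : market_move k v 0 j = eps * ((v j)%:R - (v k)%:R).
Proof. by rewrite !mxE. Qed.

Lemma sqr_enorm_market_move k v :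
  enorm (market_move k v) ^+ 2 <= n%:R * eps ^+ 2.
Proof.
rewrite sqr_enorm (_ : n%:R = \sum_(i < n) (1 : R));
  last by rewrite sumr_const card_ord.
rewrite mulr_suml; apply: ler_sum => i _; rewrite market_moveE exprMn mulrC.
by rewrite ler_wpM2r ?sqr_ge0//; case: (v i); case: (v k); rewrite /=; lra.
Qed.

(* Quantifying over [y] bounds [W] by the Moreau envelope. *)
Lemma dpp_le_proximal_cost {W} {L : R} : (0 < n)%N -> 0 <= L ->
  (forall x y, `|phi x - phi y| <= L * enorm (x - y)) ->
  coord_nondecreasing phi -> shift_equivariant phi ->
  dpp_solution T phi eps W -> forall k x y,
  W (grid_time k) x <= proximal_cost phi x y +
    (L ^+ 2 / 2 + k%:R * (n%:R * eps ^+ 2 / 2)).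
Proof.
move=> n0 L0 phiL phi_nd phi_sh solW; elim=> [|k IH] x y.
  by rewrite grid_time0 solW.2 mul0r addr0; exact: le_proximal_cost.
set c := L ^+ 2 / 2 in IH *; set d := n%:R * eps ^+ 2 / 2 in IH *.
(* It suffices to treat the minimizer [z], which also supplies the player's strategy [x - z]. *)
have [z zmin] := proximal_point _ _ L0 phiL x.
apply: (@le_trans _ _ (proximal_cost phi x z + (c + k.+1%:R * d))); last first.
  by rewrite lerD2r.
pose al := (x - z) ord0.
have pal : probability_vector al by exact: proximal_gradient_probability zmin.
apply: is_minmax_le (pal) _ (dpp_minmax k x solW) => p pp.
pose b := proximal_cost phi x z + (c + k.+1%:R * d).
(* The induction hypothesis is used at the same [z] for every moved point. Expanding the square
   leaves a linear term and |h|^2/2 <= [d], which accounts for passing from [k] to [k.+1]. *)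
have step i v : shift_payoff (W (grid_time k)) x i v <=
    b + eps * (\sum_j al j * (v j)%:R - (v i)%:R).
  apply: (le_trans (IH _ z)); rewrite /proximal_cost (addrAC x) sqr_enormD.
  have -> : \sum_j (x - z) 0 j * market_move i v 0 j =
      eps * (\sum_j al j * (v j)%:R - (v i)%:R).
    have -> : (v i)%:R = \sum_j al j * (v i)%:R.
      by rewrite -mulr_suml pal.2 mul1r.
    rewrite -sumrB mulr_sumr.
    by apply: eq_bigr => j _; rewrite market_moveE -/(al j); ring.
  have := sqr_enorm_market_move i v; rewrite /b /d /proximal_cost -(natr1 k).
  by set m := eps * _; lra.
pose A i (v : {ffun 'I_n -> bool}) : R :=
  b + eps * (\sum_j al j * (v j)%:R - (v i)%:R).
apply: (@le_trans _ _ (expected_payoff A al p)).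
  rewrite -[leRHS]addr0; apply: le_expected_payoff => // i v.
  by rewrite addr0; exact: step.
rewrite expected_payoffE; apply: ler_expectation => // v; rewrite /A.
(* Averaging over [i] with weights [al] cancels the linear term for each [v], because [al] sums to
   1. *)
under eq_bigr do rewrite mulrDr.
rewrite big_split/= -mulr_suml pal.2 mul1r gerDl.
rewrite (_ : \sum_i _ = eps *
    (\sum_i (al i * (\sum_j al j * (v j)%:R) - al i * (v i)%:R))).
  by rewrite sumrB -mulr_suml pal.2 mul1r subrr mulr0.
by rewrite mulr_sumr; apply: eq_bigr => i _; ring.
Qed.

End dynamic_programming.

(** * Existence, uniqueness, and bounds uniform in [eps] *)

Theorem theorem4 (R : realType) (n : nat) (T : R) (phi : 'rV[R]_n -> R)
    (n_gt0 : (0 < n)%N) (phi_adm : admissible_payoff phi) :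
  (forall eps : R, 0 < eps ->
     exists W : R -> 'rV[R]_n -> R, dpp_solution T phi eps W /\
       forall W' : R -> 'rV[R]_n -> R, dpp_solution T phi eps W' ->
         forall t, time_grid T eps t -> forall x, W' t x = W t x) /\
  (forall w : R -> R -> 'rV[R]_n -> R,
     (forall eps : R, 0 < eps -> dpp_solution T phi eps (w eps)) ->
     [/\ exists C : R, forall eps : R, 0 < eps ->
           forall t, time_grid T eps t ->
             (sup_norm (fun x => w eps t x - mollify phi x)%R
                < (C * (T - t + 1))%:E)%E,
         forall t0 : R, t0 <= T -> exists A B : R,
           forall eps : R, 0 < eps -> forall t, time_grid T eps t -> t0 <= t ->
             forall x, `|w eps t x| <= A * enorm x + B,
         forall eps : R, 0 < eps -> forall t, time_grid T eps t ->
           coord_nondecreasing (w eps t)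
       & forall eps : R, 0 < eps -> forall t, time_grid T eps t ->
           shift_equivariant (w eps t)]).
Proof.
case: phi_adm => [[L' phiL'] phi_nd _ [C1 [C2 phi_growth]] phi_sh]; split.
  move=> eps e0; have [W solW] := dpp_exists (T := T) (phi := phi) e0 n_gt0.
  by exists W; split => // W' solW'; exact: (dpp_unique e0 solW solW').
move=> w solw.
pose L : R := `|L'|; have L0 : 0 <= L by exact: normr_ge0.
have phiL x y : `|phi x - phi y| <= L * enorm (x - y).
  by rewrite (le_trans (phiL' x y))// ler_wpM2r ?enorm_ge0 ?ler_norm.
(* [L ^+ 2 / 2] is the gap between [phi] and its envelope; [n%:R / 2] is the growth rate per unit
   time. *)
pose K := L ^+ 2 / 2 + n%:R / 2.
have K0 : 0 <= K by rewrite addr_ge0// divr_ge0// sqr_ge0.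
have grid_le (eps t : R) : time_grid T eps t -> t <= T.
  by move=> [k _ <-]; rewrite gerBl mulr_ge0// sqr_ge0.
have w_phi (eps t : R) x : 0 < eps -> time_grid T eps t ->
    `|w eps t x - phi x| <= K * (T - t + 1).
  move=> e0 gt; have tT := grid_le _ _ gt.
  rewrite ger0_norm ?subr_ge0; last exact: dpp_ge_payoff (solw _ e0) _ gt x.
  rewrite lerBlDl; case: gt tT => k _ <- tT.
  (* Choosing [y = x] makes the proximal cost equal to [phi x], and [k%:R * eps ^+ 2] is the elapsed
     time. *)
  have := dpp_le_proximal_cost e0 n_gt0 L0 phiL phi_nd phi_sh (solw _ e0) k x x.
  rewrite /proximal_cost subrr (_ : enorm 0 ^+ 2 = 0); last first.
    by rewrite sqr_enorm big1// => i _; rewrite mxE expr0n.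
  move=> /le_trans; apply; rewrite /K /grid_time opprB addrC.
  have : 0 <= L ^+ 2 * (k%:R * eps ^+ 2)
    by exact: mulr_ge0 (sqr_ge0 _) (mulr_ge0 (ler0n _ _) (sqr_ge0 _)).
  have : 0 <= n%:R :> R by [].
  lra.
split.
(* [L] pays for the mollification, and the extra 1 makes the bound on the supremum strict, as
   [T - t + 1] is positive. *)
- exists (K + L + 1) => eps e0 t gt; have tT := grid_le _ _ gt.
  apply: (@le_lt_trans _ _ ((K + L) * (T - t + 1))%:E).
    apply: ge_ereal_sup => _ [x _ <-]; rewrite lee_fin.
    rewrite (le_trans (ler_distD (phi x) _ _))// mulrDl lerD ?w_phi//.
    rewrite distrC (le_trans (mollify_dist _ _ L0 phiL x))//.
    by rewrite ler_peMr// lerDr subr_ge0.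
  by rewrite lte_fin ltr_pM2r ?ltrDl// ltr_wpDl// subr_ge0.
(* The growth bound of [phi] plus its distance to [w], taken at the earliest time [t0]. *)
- move=> t0 t0T; exists C1, (C2 + K * (T - t0 + 1)) => eps e0 t gt t0t x.
  rewrite -[w eps t x](subrK (phi x)) (le_trans (ler_normD _ _))//.
  rewrite addrA addrC lerD// (le_trans (w_phi _ _ _ e0 gt))//.
  by rewrite ler_wpM2l// lerD2r lerD2l lerN2.
- move=> eps e0; exact: dpp_coord_nondecreasing (solw _ e0) phi_nd.
- move=> eps e0; exact: dpp_shift_equivariant (solw _ e0) phi_sh.
Qed.
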